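(* If $L$ is a unary regular language (a regular language over a one-letter alphabet), then $\mathrm{sc}(\mathrm{root}(L))\le\mathrm{sc}(L)$. This bound is tight: for every $n\ge 1$ there is a unary regular language $L$ with $\mathrm{sc}(L)=n$ and $\mathrm{sc}(\mathrm{root}(L))=n$.
   Context: For a language $L\subseteq\Sigma^*$ over a finite alphabet $\Sigma$, $\mathrm{root}(L)=\{w\in\Sigma^* : \exists n\ge 1 \text{ such that } w^n\in L\}$. The state complexity $\mathrm{sc}(L)$ of a regular language $L\subseteq\Sigma^*$ is the number of states of the smallest DFA over $\Sigma$ (with total transition function) recognizing $L$. *)

(* Defs.v *)
From mathcomp Require Import all_boot.
From mathcomp Require Import boolp classical_sets.

Set Implicit Arguments.
Unset Strict Implicit.
Unset Printing Implicit Defensive.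

Local Open Scope classical_set_scope.

Section Languages.
Variable Sigma : finType.

Record dfa := DFA {
  dfa_state : finType;
  dfa_init : dfa_state;
  dfa_final : {set dfa_state};
  dfa_trans : dfa_state -> Sigma -> dfa_state
}.

Definition dfa_lang (M : dfa) : set (seq Sigma) :=
  [set w | foldl (@dfa_trans M) (dfa_init M) w \in dfa_final M].

Definition recognizable_in (L : set (seq Sigma)) (n : nat) : Prop :=
  exists M : dfa, #|dfa_state M| = n /\ dfa_lang M = L.

Definition regular (L : set (seq Sigma)) : Prop :=
  exists n, recognizable_in L n.

Lemma regular_asbool (L : set (seq Sigma)) :
  regular L -> exists n, `[< recognizable_in L n >].
Proof. by case=> n Hn; exists n; apply/asboolP. Qed.

(* The value 0 outside the regular languages is a junk value; every DFA has
   at least one state. *)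
Definition sc (L : set (seq Sigma)) : nat :=
  match pselect (regular L) with
  | left h => ex_minn (regular_asbool h)
  | right _ => 0
  end.

Lemma scP (L : set (seq Sigma)) : regular L ->
  recognizable_in L (sc L) /\ forall n, recognizable_in L n -> sc L <= n.
Proof.
rewrite /sc; case: pselect => // h _; case: ex_minnP => m /asboolP Hm min_m.
by split=> // n Hn; apply: min_m; apply/asboolP.
Qed.

Definition word_pow (w : seq Sigma) (n : nat) : seq Sigma :=
  flatten (nseq n w).

Definition lang_root (L : set (seq Sigma)) : set (seq Sigma) :=
  [set w | exists n : nat, 1 <= n /\ L (word_pow w n)].

End Languages.

(* Main.v *)
(** Over one letter all words commute, so two words [u], [v] reaching the same
    state of a DFA from its initial state have powers [u^n], [v^n] reaching the
    same state.  Membership in the root of the language thus depends only on the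
    state reached, and the same automaton with other final states recognizes the
    root.  The bound is attained by the language of the words of length [n - 2]
    (empty for [n = 1]): it and its root have the same longest word, of length
    [n - 2], and this forces [n] distinct states. *)
Require Import Defs.
From mathcomp Require Import all_boot.
From mathcomp Require Import boolp classical_sets.
From mathcomp Require Import zify.

Set Implicit Arguments.
Unset Strict Implicit.
Unset Printing Implicit Defensive.

Local Open Scope classical_set_scope.

Lemma size_word_pow (Sigma : finType) (w : seq Sigma) n :
  size (word_pow w n) = n * size w.
Proof. by elim: n => //= n IHn; rewrite size_cat IHn mulSn. Qed.

Lemma recognizable_sc (Sigma : finType) (L : set (seq Sigma)) n :
  recognizable_in L n -> sc L <= n.
Proof. by move=> Ln; case: (@scP _ L) => [|_]; [exists n | apply]. Qed.

Lemma sc_ge (Sigma : finType) (L : set (seq Sigma)) n : regular L ->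
  (forall m, recognizable_in L m -> n <= m) -> n <= sc L.
Proof. by move=> /scP[Lsc _]; apply. Qed.

(** If [a^i] and [a^j] with [i < j < n] reached one state, the suffix completing [a^i] to length
    [n - 2] would make [a^j] an accepted word that is too long. *)
Lemma longest_word_recognizable (Sigma : finType) (a : Sigma)
    (L : set (seq Sigma)) n m :
  (forall w, L w -> size w + 2 <= n) -> (forall w, size w + 2 = n -> L w) ->
  recognizable_in L m -> n <= m.
Proof.
move=> L_le L_long [M [<- defL]].
pose st i := foldl (@dfa_trans _ M) (dfa_init M) (nseq i a).
have LE w : L w <-> foldl (@dfa_trans _ M) (dfa_init M) w \in dfa_final M.
  by rewrite -defL.
have st_neq i j : i < j < n -> st i != st j.
  case/andP=> lt_ij lt_jn; apply/eqP => eq_st.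
  (* The subtraction is not truncated: [i < j < n] gives [i <= n - 2]. *)
  pose tl := nseq (n - 2 - i) a.
  have /LE: L (nseq i a ++ tl).
    by apply: L_long; rewrite size_cat !size_nseq; lia.
  rewrite foldl_cat -/(st i) eq_st -foldl_cat => /LE/L_le.
  rewrite size_cat !size_nseq; lia.
have st_inj : injective (fun i : 'I_n => st i).
  move=> i j /eqP eq_st; apply: val_inj; apply/eqP; apply/negPn/negP.
  case: (ltngtP i j) => // lt_ij _.
    by move: (st_neq i j); rewrite lt_ij ltn_ord eq_st => /(_ isT).
  by move: (st_neq j i); rewrite lt_ij ltn_ord eq_sym eq_st => /(_ isT).
by rewrite -[n in n <= _]card_ord; apply: leq_card st_inj.
Qed.

Lemma recognizable_size_eq (Sigma : finType) n : 1 <= n ->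
  recognizable_in [set w : seq Sigma | size w + 2 = n] n.
Proof.
case: n => // n _.
(* States count the letters read, capped at [n], which is the rejecting sink; for [n = 0] only the
   sink remains. *)
pose M := @DFA Sigma 'I_n.+1 ord0 [set i : 'I_n.+1 | i + 2 == n.+1]
  (fun i _ => inord (minn i.+1 n)).
exists M; split; first exact: card_ord.
have st w (i : 'I_n.+1) :
    foldl (@dfa_trans _ M) i w = minn (i + size w) n :> nat.
  elim: w i => [|x w IHw] i /=; first by have := ltn_ord i; lia.
  rewrite IHw inordK; lia.
apply/funext => w; apply/propext; rewrite /dfa_lang /= inE st /=.
by split=> [/eqP|] ?; [|apply/eqP]; lia.
Qed.

Section Unary.
Variables (Sigma : finType) (hSigma : #|Sigma| = 1).

Lemma unary_catC (u v : seq Sigma) : u ++ v = v ++ u.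
Proof.
have /fintype1P[a all_a] : #|Sigma| == 1 by rewrite hSigma.
have nseqE w : w = nseq (size w) a.
  by apply/all_pred1P/allP => x _; rewrite /= (all_a x).
by rewrite (nseqE u) (nseqE v) -!nseqD addnC.
Qed.

Lemma foldl_word_pow (M : dfa Sigma) (q : dfa_state M) u v n :
  foldl (@dfa_trans _ M) q u = foldl (@dfa_trans _ M) q v ->
  foldl (@dfa_trans _ M) q (word_pow u n) =
  foldl (@dfa_trans _ M) q (word_pow v n).
Proof.
move=> eq_uv; elim: n => //= n IHn.
rewrite -/(word_pow u n) -/(word_pow v n) foldl_cat eq_uv -foldl_cat.
(* [IHn] and [eq_uv] only speak of runs from [q], so commutation moves [v] behind the power while
   [IHn] exchanges it. *)
by rewrite unary_catC foldl_cat IHn -foldl_cat unary_catC.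
Qed.

Lemma recognizable_root (L : set (seq Sigma)) n :
  recognizable_in L n -> recognizable_in (lang_root L) n.
Proof.
move=> [M [cardM defL]].
pose st := foldl (@dfa_trans _ M) (dfa_init M).
pose F := [set q | `[< exists2 w, st w = q & lang_root L w >]]%SET.
exists (DFA (dfa_init M) F (@dfa_trans _ M)); split=> //.
apply/funext => w; apply/propext; rewrite /dfa_lang /= inE.
split=> [/asboolP[v eq_vw [k [k_gt0 Lvk]]] | Lw]; last first.
  by apply/asboolP; exists w.
(* The exponent of the representative [v] also serves for [w]. *)
exists k; split=> //; move: Lvk.
by rewrite -defL /dfa_lang /= (foldl_word_pow k eq_vw).
Qed.

End Unary.

Theorem proposition2p1 (Sigma : finType) (hSigma : #|Sigma| = 1) :
  (forall L : set (seq Sigma), regular L ->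
     regular (lang_root L) /\ sc (lang_root L) <= sc L) /\
  (forall n : nat, 1 <= n ->
     exists L : set (seq Sigma),
       regular L /\ sc L = n /\ sc (lang_root L) = n).
Proof.
split=> [L /scP[/(recognizable_root hSigma) rootL _] | n n_gt0].
  by split; [exists (sc L) | apply: recognizable_sc].
have [a _] : exists a : Sigma, a \in Sigma by apply/card_gt0P; rewrite hSigma.
pose L := [set w : seq Sigma | size w + 2 = n].
have recL : recognizable_in L n by apply: recognizable_size_eq.
have recR := recognizable_root hSigma recL.
exists L; split; first by exists n.
split; apply/eqP; rewrite eqn_leq recognizable_sc //=.
  apply: sc_ge => [|m]; first by exists n.
  by apply: (longest_word_recognizable a) => // w; rewrite /L /= => ->.
apply: sc_ge => [|m]; first by exists n.
(* If [w^k] has length [n - 2] with [k >= 1], then [w] is no longer than that; exponent 1 gives the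
   converse at length [n - 2]. *)
apply: (longest_word_recognizable a) => w.
  by move=> [k [k_gt0]]; rewrite /L /= size_word_pow; nia.
by exists 1; rewrite /L /= size_word_pow mul1n.
Qed.
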